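(* Assume projective determinacy (PD). For each $n\in\omega$, there is a complete $\mathbf{\Pi}^1_{2n+1}$ equivalence relation on $2^\omega$; that is, there is a $\mathbf{\Pi}^1_{2n+1}$ equivalence relation $F$ on $2^\omega$ such that $E\leq_{\rm B}F$ for every $\mathbf{\Pi}^1_{2n+1}$ equivalence relation $E$ on $2^\omega$.
   Context: PD is the assertion that every two-player perfect-information game of length $\omega$ on $\omega$ with projective payoff set is determined. An equivalence relation on $2^\omega$ is $\mathbf{\Pi}^1_{2n+1}$ if it is a (boldface) $\mathbf{\Pi}^1_{2n+1}$ subset of $2^\omega\times 2^\omega$. For equivalence relations $E,F$ on a Polish space $X$, $E\leq_{\rm B}F$ ($E$ is Borel-reducible to $F$) means that there is a Borel-measurable map $f:X\to X$ such that for all $x,y\in X$, $x\,E\,y\iff f(x)\,F\,f(y)$. *)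

(* Defs.v *)
From HB Require Import structures.
From mathcomp Require Import all_boot all_order all_algebra.
From mathcomp Require Import all_classical all_reals all_analysis.
From Stdlib Require Import RelationClasses.

Set Implicit Arguments.
Unset Strict Implicit.
Unset Printing Implicit Defensive.

Local Open Scope classical_set_scope.

(* Baire space omega^omega: product of countably many copies of discrete nat.
   The companion space 2^omega is the library's [cantor_space]. *)
Definition baire_space : Type := prod_topology (fun _ : nat => nat).

HB.instance Definition _ := Pointed.copy baire_space (prod_topology _).
HB.instance Definition _ := Nbhs.copy baire_space (prod_topology _).
HB.instance Definition _ := Topological.copy baire_space (prod_topology _).

(* [Sigma1 n A]: A is boldface Sigma^1_n. The recursion starts from the
   convention that "Sigma^1_0" means open, so that Sigma^1_1 sets are the
   projections along omega^omega of closed sets, and Sigma^1_{n+1} sets are the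
   projections of Pi^1_n sets. The notion is meant for Polish X. *)
Fixpoint Sigma1 (n : nat) (X : topologicalType) (A : set X) : Prop :=
  if n is m.+1 then
    exists2 C : set (X * baire_space), Sigma1 m (~` C) & A = fst @` C
  else open A.

Definition Pi1 (n : nat) (X : topologicalType) (A : set X) : Prop :=
  Sigma1 n (~` A).

Definition projective (X : topologicalType) (A : set X) : Prop :=
  exists n, Sigma1 n.+1 A.

(* Games of length omega on omega: a play is x : nat -> nat, the position
   reached after k moves is [mkseq x k]; player I makes the moves x 0, x 2, ...
   and player II the moves x 1, x 3, ...; I wins iff x is in the payoff set. *)
Definition strategy := seq nat -> nat.

Definition follows_I (s : strategy) (x : nat -> nat) : Prop :=
  forall k, x k.*2 = s (mkseq x k.*2).

Definition follows_II (s : strategy) (x : nat -> nat) : Prop :=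
  forall k, x k.*2.+1 = s (mkseq x k.*2.+1).

Definition winning_I (A : set baire_space) (s : strategy) : Prop :=
  forall x : baire_space, follows_I s x -> A x.

Definition winning_II (A : set baire_space) (s : strategy) : Prop :=
  forall x : baire_space, follows_II s x -> ~ A x.

Definition determined (A : set baire_space) : Prop :=
  (exists s, winning_I A s) \/ (exists s, winning_II A s).

Definition PD : Prop :=
  forall A : set baire_space, projective A -> determined A.

Definition Pi1_equivalence (n : nat) (X : topologicalType)
    (E : X -> X -> Prop) : Prop :=
  Equivalence E /\ Pi1 n [set p : X * X | E p.1 p.2].

Definition borel_fun (X Y : ptopologicalType) (f : X -> Y) : Prop :=
  measurable_fun setT
    (f : g_sigma_algebraType (@open X) -> g_sigma_algebraType (@open Y)).

Definition borel_reducible (X : ptopologicalType) (E F : X -> X -> Prop) : Prop :=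
  exists2 f : X -> X, borel_fun f & forall x y, E x y <-> F (f x) (f y).

(* Main.v *)
Require Import Defs.
From mathcomp Require Import all_boot all_order all_algebra.
From mathcomp Require Import all_classical all_reals all_analysis.

(* Write Pi for Pi^1_(2n+1). Under PD the class Pi has the prewellordering
   property (Martin and Moschovakis, first periodicity theorem). A norm on a
   universal Pi set W, combined with the recursion theorem, gives bounds inside
   W: if c in W holds iff every element of a family lies strictly below c, then
   c is in W as soon as the family is contained in W, and c bounds its norms.

   Given a Pi relation U_x with parameter x, attach to (y,z) a sequence of
   stages: stage 0 is in W iff U_x(y,z), and stage k+1 is in W iff it lies above
   all pairs that symmetry and transitivity produce from pairs of norm at most
   that of stage k. The relation "all stages of (y,z) are in W" is Pi; it is
   symmetric and transitive for every x, since the stages of a smaller pair are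
   dominated by later stages of a larger one, and it coincides with U_x whenever
   U_x is an equivalence relation. Together with the diagonal these relations,
   for all x at once, form the complete equivalence relation. *)

Set Implicit Arguments.
Unset Strict Implicit.
Unset Printing Implicit Defensive.

Local Open Scope classical_set_scope.

Notation N := baire_space.

(** * Continuity on Baire space *)

(** Continuity into a discrete space, stated without a topology on [T], so that [T] may be [bool] or
    [seq nat]. *)
Definition locally_constant (X : topologicalType) (T : Type) (f : X -> T) :=
  forall x, \forall y \near x, f y = f x.

Section LocallyConstant.
Variable X : topologicalType.

Lemma lc_cst (T : Type) (c : T) : locally_constant (fun _ : X => c).
Proof. by move=> x; apply: nearW. Qed.

Lemma lc_app (T U : Type) (h : T -> U) (f : X -> T) :
  locally_constant f -> locally_constant (fun x => h (f x)).
Proof. by move=> lf x; apply: filterS (lf x) => y ->. Qed.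

Lemma lc_app2 (T U V : Type) (h : T -> U -> V) (f : X -> T) (g : X -> U) :
  locally_constant f -> locally_constant g ->
  locally_constant (fun x => h (f x) (g x)).
Proof.
by move=> lf lg x; apply: filterS2 (lf x) (lg x) => y -> ->.
Qed.

Lemma lc_case (T U : Type) (n : X -> T) (f : X -> T -> U) :
  locally_constant n -> (forall t, locally_constant (f ^~ t)) ->
  locally_constant (fun x => f x (n x)).
Proof.
by move=> ln lf x; apply: filterS2 (ln x) (lf (n x) x) => y -> ->.
Qed.

Lemma lc_open (P : set X) :
  (exists2 b : X -> bool, locally_constant b & forall x, P x <-> b x) ->
  open P.
Proof.
move=> [b lb Pb]; rewrite openE => x /Pb bx; apply: filterS (lb x) => y e.
by apply/Pb; rewrite e.
Qed.

Lemma continuous_ptws (T : discreteTopologicalType)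
    (f : X -> prod_topology (fun _ : nat => T)) :
  (forall i, locally_constant (fun x => f x i)) -> continuous f.
Proof.
move=> lf x; apply/cvg_sup => i A [B [[D oD DE] Bx] BA] /=.
rewrite /nbhs /=; apply: filterS (lf i x) => y e; apply: BA.
by move: Bx; rewrite -DE /= e.
Qed.

Lemma ptws_lc (T : discreteTopologicalType)
    (f : X -> prod_topology (fun _ : nat => T)) :
  continuous f -> forall i, locally_constant (fun x => f x i).
Proof.
move=> cf i x.
have H := cvg_comp _ _ (cf x) (@proj_continuous _ (fun=> T) i (f x)).
apply: (H [set f x i]).
by rewrite nbhs_principalE; apply/principal_filterP.
Qed.

Lemma lc_coord (f : X -> N) (n : X -> nat) :
  continuous f -> locally_constant n -> locally_constant (fun x => f x (n x)).
Proof.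
by move=> cf ln; apply: (lc_case (f := fun x k => f x k)) => // k; apply: ptws_lc.
Qed.

Lemma lc_mkseq (f : X -> N) (n : X -> nat) :
  continuous f -> locally_constant n ->
  locally_constant (fun x => mkseq (f x) (n x)).
Proof.
move=> cf ln; apply: (lc_case (f := fun x k => mkseq (f x) k)) => // k.
elim: k => [|k IH]; first exact: lc_cst.
have -> : (fun x => mkseq (f x) k.+1) = fun x => rcons (mkseq (f x) k) (f x k).
  by apply/funext => x; rewrite mkseqS.
by apply: lc_app2 => //; apply: ptws_lc.
Qed.

End LocallyConstant.

(** The cylinders around [x] generate a filter that converges to [x] in each coordinate, hence in
    the product topology. *)
Lemma nbhs_baire (x : N) (A : set N) :
  nbhs x A -> exists k, forall y : N, mkseq y k = mkseq x k -> A y.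
Proof.
pose F : set_system N := filter_from [set: nat]
  (fun k => [set y : N | mkseq y k = mkseq x k]).
have agree (k l : nat) (y : N) : k <= l -> mkseq y l = mkseq x l ->
    mkseq y k = mkseq x k.
  move=> kl e; have := congr1 (take k) e.
  by rewrite /mkseq -!map_take !take_iota (minn_idPl kl).
have FF : Filter F.
  apply: filter_from_filter; first by exists 0.
  move=> i j _ _; exists (maxn i j) => // y e.
  by split; apply: agree e; rewrite ?leq_maxl ?leq_maxr.
suff Fx : F --> x by move=> /Fx [k _ kA]; exists k.
apply/cvg_sup => i A' [B [[D oD DE] Bx] BA].
exists i.+1 => // y /= e; apply: BA; rewrite -DE /=.
have := congr1 (fun s => nth 0 s i) e; rewrite !nth_mkseq // => ->.
by move: Bx; rewrite -DE.
Qed.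

Section ContinuousMaps.
Variable X : topologicalType.

Lemma continuous_idf : continuous (fun x : X => x).
Proof. by move=> x. Qed.

Lemma continuous_fst_comp (Y Z : topologicalType) (f : X -> Y * Z) :
  continuous f -> continuous (fun x => (f x).1).
Proof. by move=> cf x; apply: (cvg_comp _ _ (cf x)); exact: cvg_fst. Qed.

Lemma continuous_snd_comp (Y Z : topologicalType) (f : X -> Y * Z) :
  continuous f -> continuous (fun x => (f x).2).
Proof. by move=> cf x; apply: (cvg_comp _ _ (cf x)); exact: cvg_snd. Qed.

Lemma continuous_pair (Y Z : topologicalType) (f : X -> Y) (g : X -> Z) :
  continuous f -> continuous g -> continuous (fun x => (f x, g x)).
Proof. by move=> cf cg x; apply: cvg_pair; [exact: cf | exact: cg]. Qed.

Lemma continuous_compf (Y Z : topologicalType) (g : Y -> Z) (f : X -> Y) :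
  continuous g -> continuous f -> continuous (fun x => g (f x)).
Proof. by move=> cg cf x; apply: (cvg_comp _ _ (cf x)); exact: cg. Qed.

Lemma continuous_cstf (Y : topologicalType) (c : Y) :
  continuous (fun _ : X => c).
Proof. by move=> x; exact: cvg_cst. Qed.

End ContinuousMaps.

(* [pr a b] interleaves [a] and [b]; a play of a game is [pr a b] where [a]
   lists the moves of player I and [b] those of player II. *)
Definition pr (a b : N) : N := fun i => if odd i then b i./2 else a i./2.
Definition ev (x : N) : N := fun i => x i.*2.
Definition od (x : N) : N := fun i => x i.*2.+1.

Lemma ev_pr a b : ev (pr a b) = a.
Proof. by apply/funext => i; rewrite /ev /pr odd_double doubleK. Qed.

Lemma od_pr a b : od (pr a b) = b.
Proof. by apply/funext => i; rewrite /od /pr /= odd_double /= uphalf_double. Qed.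

Lemma pr_ev_od x : pr (ev x) (od x) = x.
Proof.
apply/funext => i; rewrite /pr /ev /od.
by rewrite -{4}(odd_double_half i); case: ifP.
Qed.

Section ContinuousPairing.
Variable X : topologicalType.
Implicit Types f g : X -> N.

Lemma continuous_pr f g :
  continuous f -> continuous g -> continuous (fun x => pr (f x) (g x)).
Proof.
move=> cf cg; apply: continuous_ptws => i; rewrite /pr.
by case: (odd i); apply: ptws_lc.
Qed.

Lemma continuous_ev f : continuous f -> continuous (fun x => ev (f x)).
Proof. by move=> cf; apply: continuous_ptws => i; apply: ptws_lc. Qed.

Lemma continuous_od f : continuous f -> continuous (fun x => od (f x)).
Proof. by move=> cf; apply: continuous_ptws => i; apply: ptws_lc. Qed.

End ContinuousPairing.

Ltac solve_cont := repeat
  lazymatch goal with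
  | |- continuous (fun x => x) => exact: continuous_idf
  | |- continuous (fun _ => (_, _)) => apply: continuous_pair
  | |- continuous (fun _ => fst _) => apply: continuous_fst_comp
  | |- continuous (fun _ => snd _) => apply: continuous_snd_comp
  | |- continuous (fun _ => pr _ _) => apply: continuous_pr
  | |- continuous (fun _ => ev _) => apply: continuous_ev
  | |- continuous (fun _ => od _) => apply: continuous_od
  | |- continuous fst => exact: (continuous_fst_comp (@continuous_idf _))
  | |- continuous snd => exact: (continuous_snd_comp (@continuous_idf _))
  | |- continuous ev => exact: (continuous_ev (@continuous_idf _))
  | |- continuous od => exact: (continuous_od (@continuous_idf _))
  | |- continuous (fun _ => ?c) => exact: continuous_cstf
  | |- continuous _ => assumption
  end.

(** * Closure properties of the projective classes *)

Lemma Sigma1_comp n (X Y : topologicalType) (f : X -> Y) (A : set Y) :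
  continuous f -> Sigma1 n A -> Sigma1 n (fun x => A (f x)).
Proof.
elim: n X Y f A => [|n IH] X Y f A cf /=.
  by move=> oA; apply: (@open_comp _ _ f) => // x _; exact: cf.
move=> [C sC AE]; exists (fun q => C (f q.1, q.2)).
  apply: (IH _ _ (fun q : X * N => (f q.1, q.2)) (~` C)) => //.
  by apply: continuous_pair; [apply: (continuous_compf cf) |]; solve_cont.
rewrite AE; apply/seteqP; split=> x.
  by move=> [[z y] /= Czy zx]; exists (x, y) => //=; rewrite -zx.
by move=> [[z y] /= Czy <-]; exists (f z, y).
Qed.

Lemma Pi1_comp n (X Y : topologicalType) (f : X -> Y) (A : set Y) :
  continuous f -> Pi1 n A -> Pi1 n (fun x => A (f x)).
Proof. exact: Sigma1_comp. Qed.

Lemma Sigma1_iff n (X : topologicalType) (A B : set X) :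
  (forall x, A x <-> B x) -> Sigma1 n A -> Sigma1 n B.
Proof. by move=> AB; have -> : A = B by apply/funext => x; apply/propext. Qed.

Lemma Pi1_iff n (X : topologicalType) (A B : set X) :
  (forall x, A x <-> B x) -> Pi1 n A -> Pi1 n B.
Proof. by move=> AB; have -> : A = B by apply/funext => x; apply/propext. Qed.

Lemma Pi1_not n (X : topologicalType) (A : set X) :
  Sigma1 n A -> Pi1 n (fun x => ~ A x).
Proof. by move=> sA; apply: Sigma1_iff sA => x; split=> [Ax|/contrapT//]; apply. Qed.

Lemma Sigma1_succP n (X : topologicalType) (A : set X) :
  Sigma1 n.+1 A <->
  exists2 C : set (X * N), Pi1 n C & forall x, A x <-> exists y, C (x, y).
Proof.
split=> [[C pC ->]|[C pC AC]]; exists C => //.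
  move=> x; split=> [[[z y] Czy /= <-]|[y Cxy]]; first by exists y.
  by exists (x, y).
apply/seteqP; split=> x; first by move=> /AC[y Cxy]; exists (x, y).
by move=> [[z y] Czy /= <-]; apply/AC; exists y.
Qed.

Lemma Sigma1_and_or n (X : topologicalType) :
  (forall A B : set X, Sigma1 n A -> Sigma1 n B ->
     Sigma1 n (fun x => A x /\ B x) /\ Sigma1 n (fun x => A x \/ B x)).
Proof.
elim: n X => [|n IH] X A B.
  by move=> oA oB; split; [exact: openI | exact: openU].
(* Complementation exchanges the two connectives, which is why one induction treats both. *)
have PIH (C D : set (X * N)) : Pi1 n C -> Pi1 n D ->
    Pi1 n (fun x => C x /\ D x) /\ Pi1 n (fun x => C x \/ D x).
  move=> pC pD; have [sI sU] := IH _ _ _ pC pD; split.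
    by apply: Sigma1_iff sU => x; rewrite /setC /= not_andP.
  by apply: Sigma1_iff sI => x; rewrite /setC /= not_orP.
move=> /Sigma1_succP[C pC AC] /Sigma1_succP[D pD BD]; split; apply/Sigma1_succP.
  exists (fun q => C (q.1, ev q.2) /\ D (q.1, od q.2)).
    have pC' : Pi1 n (fun q : X * N => C (q.1, ev q.2)).
      apply: (Pi1_comp (f := fun q : X * N => (q.1, ev q.2))) => //.
      by solve_cont.
    have pD' : Pi1 n (fun q : X * N => D (q.1, od q.2)).
      apply: (Pi1_comp (f := fun q : X * N => (q.1, od q.2))) => //.
      by solve_cont.
    exact: (PIH _ _ pC' pD').1.
  move=> x; split=> [[/AC[y Cy] /BD[z Dz]]|[y [/= Cy Dy]]].
    by exists (pr y z); rewrite /= ev_pr od_pr.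
  by split; [apply/AC; exists (ev y) | apply/BD; exists (od y)].
exists (fun q => C q \/ D q); first exact: (PIH C D pC pD).2.
move=> x; split=> [[/AC[y ?]|/BD[y ?]]|[y [?|?]]].
- by exists y; left.
- by exists y; right.
- by left; apply/AC; exists y.
- by right; apply/BD; exists y.
Qed.

Section BooleanClosure.
Variables (n : nat) (X : topologicalType).
Implicit Types A B : set X.

Lemma Sigma1_and A B :
  Sigma1 n A -> Sigma1 n B -> Sigma1 n (fun x => A x /\ B x).
Proof. by move=> sA sB; case: (Sigma1_and_or sA sB). Qed.

Lemma Sigma1_or A B :
  Sigma1 n A -> Sigma1 n B -> Sigma1 n (fun x => A x \/ B x).
Proof. by move=> sA sB; case: (Sigma1_and_or sA sB). Qed.

Lemma Pi1_and A B : Pi1 n A -> Pi1 n B -> Pi1 n (fun x => A x /\ B x).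
Proof.
move=> pA pB; apply: Sigma1_iff (Sigma1_or pA pB) => x.
by rewrite /setC /= not_andP.
Qed.

Lemma Pi1_or A B : Pi1 n A -> Pi1 n B -> Pi1 n (fun x => A x \/ B x).
Proof.
move=> pA pB; apply: Sigma1_iff (Sigma1_and pA pB) => x.
by rewrite /setC /= not_orP.
Qed.

End BooleanClosure.

(** Two successive witnesses are merged into one by [pr]; at level 0 the projection is an open
    map. *)
Lemma Sigma1_ex n (X : topologicalType) (P : X -> N -> Prop) :
  Sigma1 n (fun q : X * N => P q.1 q.2) -> Sigma1 n (fun x => exists y, P x y).
Proof.
case: n => [oP|n].
  apply: (Sigma1_iff (n := 0) _ (fst_open oP)) => x.
  by split=> [[[z y] /= Pzy <-]|[y Pxy]]; [exists y | exists (x, y)].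
move=> /Sigma1_succP[C pC PC]; apply/Sigma1_succP.
exists (fun q => C ((q.1, ev q.2), od q.2)).
  apply: (Pi1_comp (f := fun q : X * N => ((q.1, ev q.2), od q.2))) => //.
  by solve_cont.
move=> x; split=> [[y /(PC (x, y))[z Cz]]|[y Cy]].
  by exists (pr y z); rewrite /= ev_pr od_pr.
by exists (ev y); apply/(PC (x, ev y)); exists (od y).
Qed.

Lemma Pi1_all n (X : topologicalType) (P : X -> N -> Prop) :
  Pi1 n (fun q : X * N => P q.1 q.2) -> Pi1 n (fun x => forall y, P x y).
Proof.
move=> pP; apply: Sigma1_iff (Sigma1_ex (P := fun x y => ~ P x y) pP) => x.
by rewrite /setC /= existsNP.
Qed.

Lemma Pi1_Sigma1_succ n (X : topologicalType) (A : set X) :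
  Pi1 n A -> Sigma1 n.+1 A.
Proof.
move=> pA; apply/Sigma1_succP; exists (fun q => A q.1).
  by apply: Pi1_comp => //; solve_cont.
by move=> x; split=> [|[]//]; exists (fun=> 0).
Qed.

Lemma Sigma1_Pi1_succ n (X : topologicalType) (A : set X) :
  Sigma1 n A -> Pi1 n.+1 A.
Proof. by move=> sA; apply: Pi1_Sigma1_succ; apply: Pi1_not. Qed.

Lemma Sigma1_ex_Pi1 n (X : topologicalType) (P : X -> N -> Prop) :
  Pi1 n (fun q : X * N => P q.1 q.2) -> Sigma1 n.+1 (fun x => exists y, P x y).
Proof. by move=> pP; apply: Sigma1_ex; apply: Pi1_Sigma1_succ. Qed.

Lemma Pi1_all_Sigma1 n (X : topologicalType) (P : X -> N -> Prop) :
  Sigma1 n (fun q : X * N => P q.1 q.2) -> Pi1 n.+1 (fun x => forall y, P x y).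
Proof. by move=> sP; apply: Pi1_all; apply: Sigma1_Pi1_succ. Qed.

Lemma Sigma1_lc n (X : topologicalType) (b : X -> bool) :
  locally_constant b -> Sigma1 n (fun x => b x).
Proof.
suff H m (c : X -> bool) : locally_constant c ->
    Sigma1 m (fun x => c x) /\ Pi1 m (fun x => c x).
  by move=> lb; case: (H n b lb).
elim: m c => [|m IH] c lc.
  split; first by apply: lc_open; exists c.
  apply: lc_open; exists (fun x => ~~ c x); first exact: lc_app.
  by move=> x; split=> /negP.
have [sc pc] := IH c lc.
by split; [exact: Pi1_Sigma1_succ | exact: Sigma1_Pi1_succ].
Qed.

Lemma Pi1_lc n (X : topologicalType) (b : X -> bool) :
  locally_constant b -> Pi1 n (fun x => b x).
Proof.
move=> lb; apply: Sigma1_iff (Sigma1_lc n (b := fun x => ~~ b x) _).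
  by move=> x; split=> /negP.
exact: lc_app.
Qed.

Lemma openP_baire (A : set N) : open A ->
  exists S : seq nat -> bool, forall x, A x <-> exists k, S (mkseq x k).
Proof.
move=> oA.
exists (fun s => `[< forall y : N, mkseq y (size s) = s -> A y >]) => x.
split=> [Ax|[k /asboolP]]; last first.
  by rewrite size_mkseq; apply.
have [k kA] := nbhs_baire (open_nbhs_nbhs (conj oA Ax)).
by exists k; apply/asboolP; rewrite size_mkseq.
Qed.

Lemma open_ex_lc (X : topologicalType) (b : X -> nat -> bool) :
  (forall k, locally_constant (b ^~ k)) -> open (fun x => exists k, b x k).
Proof.
move=> lb; rewrite openE => x [k bxk]; apply: filterS (lb k x) => y e.
by exists k; rewrite e.
Qed.

Lemma Sigma1_projective n (A : set N) : Sigma1 n A -> projective A.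
Proof.
case: n => [oA|n sA]; last by exists n.
(* The projective hierarchy starts at level 1, so an open set is rewritten as a projection, with the
   length [k] stored in [y 0]. *)
have [S AS] := openP_baire oA; exists 0.
apply: (Sigma1_iff (A := fun x : N => exists y : N, S (mkseq x (y 0)))).
  move=> x; split=> [[y Sy]|/AS[k Sk]]; last by exists (fun=> k).
  by apply/AS; exists (y 0).
apply: (Sigma1_ex_Pi1 (P := fun x y : N => S (mkseq x (y 0)))); apply: Pi1_lc.
by apply: lc_app; apply: lc_mkseq; [| apply: ptws_lc]; solve_cont.
Qed.

(** At level 0 the code [a] marks, through [pickle], the finite sequences whose cylinders make up
    the open set; each further level negates and projects the previous one. *)
Fixpoint univ (n : nat) (a x : N) : Prop :=
  if n is m.+1 then exists y, ~ univ m a (pr x y)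
  else exists k, a (pickle (mkseq x k)) != 0.

Lemma Sigma1_univ n : Sigma1 n (fun q : N * N => univ n q.1 q.2).
Proof.
elim: n => [|n IH] /=.
  apply: (open_ex_lc
    (b := fun (q : N * N) k => q.1 (pickle (mkseq q.2 k)) != 0)) => k.
  apply: (lc_app (fun i : nat => i != 0)
    (f := fun q : N * N => q.1 (pickle (mkseq q.2 k)))).
  apply: lc_coord; first by solve_cont.
  by apply: lc_app; apply: lc_mkseq; [solve_cont | exact: lc_cst].
apply: (@Sigma1_ex_Pi1 n _ (fun (q : N * N) (y : N) => ~ univ n q.1 (pr q.2 y))).
apply: Pi1_not.
apply: (Sigma1_comp (f := fun q : (N * N) * N => (q.1.1, pr q.1.2 q.2)) _ IH).
by solve_cont.
Qed.

(** The code can be chosen with values 0 and 1, so that it fits into a point of Cantor space. *)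
Lemma univ_complete n (A : set N) : Sigma1 n A ->
  exists a : nat -> bool, forall x, A x <-> univ n (fun i => a i) x.
Proof.
elim: n A => [|n IH] A.
  move=> /openP_baire[S AS].
  exists (fun i => if unpickle i is Some s then S s else false) => x.
  by rewrite AS; split=> -[k Sk]; exists k; move: Sk; rewrite pickleK; case: (S _).
move=> /Sigma1_succP[C pC AC].
have [a Ca] : exists a : nat -> bool,
    forall z, ~ C (ev z, od z) <-> univ n (fun i => a i) z.
  apply: IH; apply: (Pi1_comp (f := fun z : N => (ev z, od z)) _ pC).
  by solve_cont.
exists a => x; rewrite AC /=; split=> -[y].
  by move=> Cxy; exists y => /Ca; rewrite ev_pr od_pr.
by move=> nu; exists y; apply: contrapT => nC; apply/nu/Ca; rewrite ev_pr od_pr.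
Qed.

(** * Strategies and determinacy *)

(* [actI t b] and [actII t a] are the moves of players I and II following the
   strategy coded by [t]; I answers the first [k] moves of II, whereas II also
   sees the [k]-th move of I. *)
Definition actI (t b : N) : N := fun k => t (pickle (mkseq b k)).
Definition actII (t a : N) : N := fun k => t (pickle (mkseq a k.+1)).

Section ContinuousActions.
Variables (X : topologicalType) (f g : X -> N).
Hypotheses (cf : continuous f) (cg : continuous g).

Lemma continuous_actI : continuous (fun x => actI (f x) (g x)).
Proof.
apply: continuous_ptws => k; apply: lc_coord => //.
by apply: lc_app; apply: lc_mkseq => //; exact: lc_cst.
Qed.

Lemma continuous_actII : continuous (fun x => actII (f x) (g x)).
Proof.
apply: continuous_ptws => k; apply: lc_coord => //.
by apply: lc_app; apply: lc_mkseq => //; exact: lc_cst.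
Qed.

End ContinuousActions.

Lemma mkseq_eqP (x y : N) k :
  mkseq x k = mkseq y k <-> forall i, i < k -> x i = y i.
Proof.
split=> [e i ik|e].
  by have := congr1 (fun s => nth 0 s i) e; rewrite !nth_mkseq.
apply: (@eq_from_nth _ 0); rewrite !size_mkseq // => i ik.
by rewrite !nth_mkseq // e.
Qed.

Lemma mkseq_le (x y : N) j k : j <= k ->
  mkseq x k = mkseq y k -> mkseq x j = mkseq y j.
Proof.
move=> jk /mkseq_eqP e; apply/mkseq_eqP => i ij.
by apply: e; apply: leq_trans jk.
Qed.

(** Move [k] of I depends only on the first [k] moves of II. The value gained makes compositions of
    strategies that contain [actI] fit [contraction_fixpoint]. *)
Lemma mkseq_actI t (b b' : N) k : mkseq b k = mkseq b' k ->
  mkseq (actI t b) k.+1 = mkseq (actI t b') k.+1.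
Proof.
move=> e; apply/mkseq_eqP => i ik; rewrite /actI.
by rewrite (mkseq_le _ e).
Qed.

Lemma mkseq_actII t (b b' : N) k : mkseq b k = mkseq b' k ->
  mkseq (actII t b) k = mkseq (actII t b') k.
Proof.
move=> e; apply/mkseq_eqP => i ik; rewrite /actII.
by rewrite (mkseq_le _ e).
Qed.

(* The position after [k] rounds when I follows [s] against the moves [b]. *)
Fixpoint playI (s : strategy) (b : N) k : seq nat :=
  if k is j.+1 then
    let p := playI s b j in rcons (rcons p (s p)) (b j)
  else [::].

Fixpoint playII (s : strategy) (a : N) k : seq nat :=
  if k is j.+1 then
    let p := rcons (playII s a j) (a j) in rcons p (s p)
  else [::].

Lemma mkseq_pr a b k : mkseq (pr a b) k.+1.*2 =
  rcons (rcons (mkseq (pr a b) k.*2) (a k)) (b k).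
Proof.
by rewrite doubleS !mkseqS /pr /= odd_double /= uphalf_double doubleK.
Qed.

Lemma playI_mkseq s (a b : N) k : (forall i, a i = s (playI s b i)) ->
  playI s b k = mkseq (pr a b) k.*2.
Proof.
by move=> e; elim: k => // k IH; rewrite mkseq_pr /= -IH e.
Qed.

Lemma playII_mkseq s (a b : N) k :
  (forall i, b i = s (rcons (playII s a i) (a i))) ->
  playII s a k = mkseq (pr a b) k.*2.
Proof.
by move=> e; elim: k => // k IH; rewrite mkseq_pr /= -IH e.
Qed.

Lemma playI_ext s (b b' : N) k : mkseq b k = mkseq b' k ->
  playI s b k = playI s b' k.
Proof.
elim: k => // k IH e; rewrite /= (IH (mkseq_le (leqnSn k) e)).
by move/mkseq_eqP: e => ->.
Qed.

Lemma playII_ext s (b b' : N) k : mkseq b k = mkseq b' k ->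
  playII s b k = playII s b' k.
Proof.
elim: k => // k IH e; rewrite /= (IH (mkseq_le (leqnSn k) e)).
by move/mkseq_eqP: e => ->.
Qed.

Lemma nth_mkseqK (b : N) k : mkseq (nth 0 (mkseq b k)) k = mkseq b k.
Proof. by apply/mkseq_eqP => i ik; rewrite nth_mkseq. Qed.

Lemma determined_act (R : N -> N -> Prop) :
  determined (fun x => R (ev x) (od x)) ->
  (exists t, forall b, R (actI t b) b) \/ (exists t, forall a, ~ R a (actII t a)).
Proof.
move=> [[s win]|[s win]]; [left|right].
  (* [u] lists the moves of II so far; padded with 0 it lets the position be replayed, and the
     padding is never consulted. *)
  exists (fun i => if unpickle i is Some u
                   then s (playI s (nth 0 u) (size u)) else 0) => b.
  set a := actI _ b.
  have aE i : a i = s (playI s b i).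
    by rewrite /a /actI pickleK size_mkseq (playI_ext s (nth_mkseqK b i)).
  have := win (pr a b); rewrite ev_pr od_pr; apply=> k.
  by rewrite -(playI_mkseq _ aE) -aE /pr odd_double doubleK.
(* Here [u] already ends with the current move of I, so only [(size u).-1] rounds are complete. *)
exists (fun i => if unpickle i is Some u
                 then s (rcons (playII s (nth 0 u) (size u).-1) (last 0 u))
                 else 0) => a.
set b := actII _ a.
have bE i : b i = s (rcons (playII s a i) (a i)).
  rewrite /b /actII pickleK size_mkseq mkseqS last_rcons succnK.
  rewrite (playII_ext s (b' := a)) //.
  by apply/mkseq_eqP => j ji; rewrite nth_rcons size_mkseq ji nth_mkseq.
have := win (pr a b); rewrite ev_pr od_pr; apply=> k.
rewrite mkseqS -(playII_mkseq _ bE) /pr /= odd_double /= uphalf_double doubleK.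
exact: bE.
Qed.

Lemma PD_game n (R : N -> N -> Prop) : PD ->
  Sigma1 n (fun q : N * N => R q.1 q.2) ->
  (exists t, forall b, R (actI t b) b) \/ (exists t, forall a, ~ R a (actII t a)).
Proof.
move=> pd sR; apply: determined_act; apply: pd; apply: (@Sigma1_projective n).
apply: (Sigma1_comp (f := fun x : N => (ev x, od x)) _ sR).
by solve_cont.
Qed.

(** * Prewellorderings *)

(* Norms (prewellorderings) on [W] presented without ordinals: with [phi] the
   norm, [le x y] stands for [W x /\ (W y -> phi x <= phi y)] and [lt x y] for
   [W x /\ (W y -> phi x < phi y)]. *)
Record is_norm (T : Type) (W : set T) (le lt : T -> T -> Prop) : Prop := IsNorm {
  norm_dom : forall x y, le x y -> W x;
  norm_out : forall x y, W x -> ~ W y -> le x y;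
  norm_total : forall x y, W x -> W y -> le x y \/ le y x;
  norm_trans : forall x y z, le x y -> le y z -> le x z;
  norm_ltE : forall x y, lt x y <-> W x /\ ~ le y x;
  norm_min : forall B : set T, (exists2 x, B x & W x) ->
    exists2 x, B x & forall y, B y -> le x y }.

Definition prewellordered (G : forall X : topologicalType, set X -> Prop) :=
  forall A : set N, G _ A -> exists le lt : N -> N -> Prop,
    [/\ is_norm A le lt, G (N * N)%type (fun q => le q.1 q.2)
      & G (N * N)%type (fun q => lt q.1 q.2)].

(** The norm of [x] is the least [k] with [S (mkseq x k)]; comparing norms inspects finite prefixes
    only and is thus an open condition. *)
Lemma prewellordered_open : prewellordered (Sigma1 0).
Proof.
move=> A /openP_baire[S AS].
pose le (x y : N) := exists2 k, S (mkseq x k) & forall j, S (mkseq y j) -> k <= j.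
pose lt (x y : N) := exists2 k, S (mkseq x k) & forall j, S (mkseq y j) -> k < j.
have least (x : N) : A x ->
    exists2 k, S (mkseq x k) & forall j, S (mkseq x j) -> k <= j.
  by move=> /AS xk; case: (ex_minnP xk) => k; exists k.
have before (y : N) k : (forall j, S (mkseq y j) -> k <= j) <->
    all (fun j => ~~ S (take j (mkseq y k))) (iota 0 k).
  have takeE j : j < k -> take j (mkseq y k) = mkseq y j.
    by move=> jk; rewrite /mkseq -map_take take_iota (minn_idPl (ltnW jk)).
  split=> [Sk|/allP Sk j Sj].
    apply/allP => j; rewrite mem_iota add0n /= => jk; rewrite takeE //.
    by apply/negP => /Sk; rewrite leqNgt jk.
  rewrite leqNgt; apply/negP => jk; have := Sk j.
  by rewrite mem_iota add0n jk takeE // Sj => /(_ isT).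
exists le, lt; split; first split.
- by move=> x y [k Sk _]; apply/AS; exists k.
- move=> x y /least[k Sk _] nAy; exists k => // j Sj.
  by exfalso; apply: nAy; apply/AS; exists j.
- move=> x y /least[k Sk mk] /least[l Sl ml]; case/orP: (leq_total k l) => kl.
    by left; exists k => // j /ml; apply: leq_trans.
  by right; exists l => // j /mk; apply: leq_trans.
- move=> x y z [k Sk mk] [l Sl ml]; exists k => // j /ml; apply: leq_trans.
  exact: mk.
- move=> x y; split=> [[k Sk mk]|[/least[k Sk mk] nle]].
    split; first by apply/AS; exists k.
    by move=> [l /mk kl ml]; have := ml k Sk; rewrite leqNgt kl.
  exists k => // j Sj; rewrite ltnNge; apply/negP => jk; apply: nle.
  by exists j => // i /mk; apply: leq_trans.
- move=> B [x Bx /AS[k Sk]].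
  pose p k := `[< exists2 x, B x & S (mkseq x k) >].
  have exp : exists k, p k by exists k; apply/asboolP; exists x.
  case: (ex_minnP exp) => m /asboolP[y By Sm] mm; exists y => // z Bz.
  by exists m => // j Sj; apply: mm; apply/asboolP; exists z.
- apply: (Sigma1_iff (n := 0) (A := fun q : N * N => exists k, S (mkseq q.1 k) &&
    all (fun j => ~~ S (take j (mkseq q.2 k))) (iota 0 k))).
    move=> q; split=> [[k /andP[Sk /before mk]]|[k Sk /before mk]]; exists k => //.
    by rewrite Sk.
  apply: (open_ex_lc (b := fun (q : N * N) k => S (mkseq q.1 k) &&
    all (fun j => ~~ S (take j (mkseq q.2 k))) (iota 0 k))) => k.
  apply: lc_app2.
    by apply: lc_app; apply: lc_mkseq; [solve_cont|exact: lc_cst].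
  apply: (lc_app (fun s => all (fun j => ~~ S (take j s)) (iota 0 k))
    (f := fun q : N * N => mkseq q.2 k)).
  by apply: lc_mkseq; [solve_cont|exact: lc_cst].
- apply: (Sigma1_iff (n := 0) (A := fun q : N * N => exists k, S (mkseq q.1 k) &&
    all (fun j => ~~ S (take j (mkseq q.2 k.+1))) (iota 0 k.+1))).
    move=> q; split=> [[k /andP[Sk /before mk]]|[k Sk /before mk]]; exists k => //.
    by rewrite Sk.
  apply: (open_ex_lc (b := fun (q : N * N) k => S (mkseq q.1 k) &&
    all (fun j => ~~ S (take j (mkseq q.2 k.+1))) (iota 0 k.+1))) => k.
  apply: lc_app2.
    by apply: lc_app; apply: lc_mkseq; [solve_cont|exact: lc_cst].
  apply: (lc_app (fun s => all (fun j => ~~ S (take j s)) (iota 0 k.+1))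
    (f := fun q : N * N => mkseq q.2 k.+1)).
  by apply: lc_mkseq; [solve_cont|exact: lc_cst].
Qed.

(** The norm of [x] is the least norm of [pr x y] over all [y]. Comparison takes an exists-forall
    form whose inner quantifier the Pi class absorbs. *)
Lemma prewellordered_Sigma1 n :
  prewellordered (Pi1 n.+1) -> prewellordered (Sigma1 n.+2).
Proof.
move=> pwo A /Sigma1_succP[C pC AC].
have pC' : Pi1 n.+1 (fun z : N => C (ev z, od z)).
  by apply: (Pi1_comp (f := fun z : N => (ev z, od z)) _ pC); solve_cont.
have [le [lt [Hn ple plt]]] := pwo _ pC'.
have AP x : A x <-> exists y, C (ev (pr x y), od (pr x y)).
  by rewrite AC; split=> -[y Cy]; exists y; move: Cy; rewrite ev_pr od_pr.
have definable (R : N -> N -> Prop) : Pi1 n.+1 (fun q : N * N => R q.1 q.2) ->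
    Sigma1 n.+2 (fun q : N * N =>
      exists y, forall y', R (pr q.1 y) (pr q.2 y')).
  move=> pR; apply: Sigma1_ex_Pi1; apply: Pi1_all.
  apply: (Pi1_comp
    (f := fun q : N * N * N * N => (pr q.1.1.1 q.1.2, pr q.1.1.2 q.2)) _ pR).
  by solve_cont.
have least x : A x -> exists y, forall y', le (pr x y) (pr x y').
  move=> /AP[y Cy].
  have [|z Bz mz] := norm_min Hn (B := fun z => ev z = x).
    by exists (pr x y) => //; rewrite ev_pr.
  by exists (od z) => y'; rewrite -Bz pr_ev_od; apply: mz; rewrite ev_pr.
exists (fun x x' => exists y, forall y', le (pr x y) (pr x' y')),
  (fun x x' => exists y, forall y', lt (pr x y) (pr x' y')); split.
- split.
  + move=> x x' [y ley]; apply/AP; exists y.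
    exact: (norm_dom Hn (ley (fun=> 0))).
  + move=> x x' /AP[y Cy] nA; exists y => y'; apply: (norm_out Hn) => // Cy'.
    by apply: nA; apply/AP; exists y'.
  + move=> x x' /least[y my] /least[y' my'].
    have [l|l] := norm_total Hn (norm_dom Hn (my y)) (norm_dom Hn (my' y')).
      by left; exists y => z; apply: (norm_trans Hn) (my' z).
    by right; exists y' => z; apply: (norm_trans Hn) (my z).
  + move=> x x' x'' [y ly] [y' ly']; exists y => z.
    exact: (norm_trans Hn) (ly y') (ly' z).
  + move=> x x'; split=> [[y lty]|[/least[y my] nle]].
      split; first by apply/AP; exists y; case/(norm_ltE Hn): (lty (fun=> 0)).
      by move=> [y' ley']; case/(norm_ltE Hn): (lty y') => _; apply.
    exists y => y'; apply/(norm_ltE Hn); split; first exact: (norm_dom Hn (my y)).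
    move=> l; apply: nle; exists y' => z.
    exact: (norm_trans Hn) l (my z).
  + move=> B [x Bx /AP[y Cy]].
    have [|z Bz mz] := norm_min Hn (B := fun z => B (ev z)).
      by exists (pr x y) => //; rewrite ev_pr.
    exists (ev z) => // x' Bx'; exists (od z) => y'.
    by rewrite pr_ev_od; apply: mz; rewrite ev_pr.
- exact: definable.
- exact: definable.
Qed.

(** * First periodicity: strategies played against each other *)

Fixpoint iter_prefix (f : N -> N) k : seq nat :=
  if k is j.+1 then let s := iter_prefix f j in rcons s (f (nth 0 s) j)
  else [::].

(** The first [k] values of [b] determine [f b k], so [b] is built by recursion. Such fixed points
    are the plays that arise when strategies answer one another. *)
Lemma contraction_fixpoint (f : N -> N) :
  (forall k b b', mkseq b k = mkseq b' k ->
     mkseq (f b) k.+1 = mkseq (f b') k.+1) ->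
  exists b, f b = b.
Proof.
move=> cf; pose b : N := fun k => f (nth 0 (iter_prefix f k)) k.
have bE k : iter_prefix f k = mkseq b k.
  by elim: k => // k IH; rewrite mkseqS -IH.
exists b; apply/funext => k; rewrite {2}/b bE.
by have /mkseq_eqP -> // := cf k b (nth 0 (mkseq b k)) (esym (nth_mkseqK b k)).
Qed.

Fixpoint chain_prefix (t : nat -> N) k (i : nat) : seq nat :=
  if k is j.+1 then
    rcons (chain_prefix t j i) (t i (pickle (chain_prefix t j i.+1)))
  else [::].

(* All games of a sequence played at once, the moves of I in game [i+1] serving
   as the moves of II in game [i]. *)
Lemma actI_chain (t : nat -> N) :
  exists a : nat -> N, forall i, a i = actI (t i) (a i.+1).
Proof.
pose a i : N := fun k => t i (pickle (chain_prefix t k i.+1)).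
have aE k i : chain_prefix t k i = mkseq (a i) k.
  by elim: k => // k IH; rewrite mkseqS -IH.
by exists a => i; apply/funext => k; rewrite /actI -aE.
Qed.

(** First periodicity theorem: each player builds a second coordinate for one of the two points, and
    the given norm compares the outcomes. *)
Lemma prewellordered_Pi1 n :
  PD -> prewellordered (Sigma1 n) -> prewellordered (Pi1 n.+1).
Proof.
move=> pd pwo A /Sigma1_succP[C pC AC].
have sP : Sigma1 n (fun z : N => ~ C (ev z, od z)).
  by apply: (Pi1_comp (f := fun z : N => (ev z, od z)) _ pC); solve_cont.
have [le [lt [Hn sle slt]]] := pwo _ sP.
set P := (fun z : N => _) in Hn.
have AP x : A x <-> forall y, P (pr x y).
  split=> [Ax y|Px].
    rewrite /P ev_pr od_pr => Cy; have : ~ ~ A x by [].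
    by apply; apply/AC; exists y.
  apply: contrapT => /AC[y Cy]; have := Px y.
  by rewrite /P ev_pr od_pr; apply.
(* I builds [a] for [x], II builds [b] for [x'], and II wins iff [le (pr x a) (pr x' b)]. [le'] says
   that I has no winning strategy, a form of the right complexity; [lt'] says that II, now building
   for [x], has no strategy preventing [lt]. *)
pose le' x x' := forall t, exists b, le (pr x (actI t b)) (pr x' b).
pose lt' x x' := forall t, exists a, lt (pr x (actII t a)) (pr x' a).
have not_leP x x' :
    ~ le' x x' <-> exists t, forall b, ~ le (pr x (actI t b)) (pr x' b).
  by rewrite /le' -existsNP; split=> -[t Ht]; exists t; apply/forallNP.
(* Determinacy gives II a winning strategy; conversely, the strategies [s] of I and [t] of II play
   each other. *)
have leP x x' :
    le' x x' <-> exists t, forall a, le (pr x a) (pr x' (actII t a)).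
  split=> [lxx'|[t Ht] s].
    have [|[t Ht]|[t Ht]] :=
        @PD_game n.+1 (fun a b => ~ le (pr x a) (pr x' b)) pd.
    - apply: Pi1_Sigma1_succ; apply: Pi1_not.
      apply: (Sigma1_comp (f := fun q : N * N => (pr x q.1, pr x' q.2)) _ sle).
      by solve_cont.
    - by have [b] := lxx' t; move/Ht.
    - by exists t => a; apply: contrapT; apply: Ht.
  have [b bE] : exists b, actII t (actI s b) = b.
    apply: contraction_fixpoint => k b b' e; apply: mkseq_actII.
    exact: mkseq_actI.
  by exists b; rewrite -{2}bE.
have ltP x x' :
    lt' x x' <-> exists t, forall b, lt (pr x b) (pr x' (actI t b)).
  split=> [lxx'|[t Ht] s].
    have [|[t Ht]|[t Ht]] := @PD_game n (fun a b => lt (pr x b) (pr x' a)) pd.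
    - apply: (Sigma1_comp (f := fun q : N * N => (pr x q.2, pr x' q.1)) _ slt).
      by solve_cont.
    - by exists t.
    - by have [a] := lxx' t; move/Ht.
  have [a aE] : exists a, actI t (actII s a) = a.
    apply: contraction_fixpoint => k b b' e; apply: mkseq_actI.
    exact: mkseq_actII.
  by exists a; rewrite -{2}aE.
have out x x' : A x -> ~ A x' -> le' x x'.
  move=> /AP Px /AP/existsNP[y nPy] t; exists y.
  exact: (norm_out Hn).
exists le', lt'; split.
- split=> //.
  + by move=> x x' /leP[t Ht]; apply/AP => y; apply: (norm_dom Hn (Ht y)).
  + move=> x x' /AP Px /AP Px'.
    (* A strategy [t] of I refuting [le' x x'] is copied to the reversed board: the output of [t]
       answers [s], and that of [s] answers [t]. *)
    apply: contrapT => /not_orP[/not_leP[t Ht]]; apply => s.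
    have [b bE] : exists b, actI t (actI s b) = b.
      apply: contraction_fixpoint => k b b' e.
      by apply: mkseq_le (leqnSn _) _; do 2!apply: mkseq_actI.
    exists b; rewrite -{2}bE.
    by case: (norm_total Hn (Px (actI t (actI s b))) (Px' (actI s b))) => // /Ht.
  + move=> x x' x'' /leP[t Ht] /leP[u Hu] s.
    (* Two strategies of II run in tandem: the answers of [t] for [x'] become the moves that [u]
       answers. *)
    have [c cE] : exists c, actII u (actII t (actI s c)) = c.
      apply: contraction_fixpoint => k b b' e; do 2!apply: mkseq_actII.
      exact: mkseq_actI.
    exists c; rewrite -{2}cE.
    exact: (norm_trans Hn) (Ht _) (Hu _).
  + move=> x x'; rewrite not_leP; split=> [/ltP[t Ht]|[/AP Px [t Ht]]].
      split; first by apply/AP => y; case/(norm_ltE Hn): (Ht y).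
      by exists t => b; case/(norm_ltE Hn): (Ht b).
    by apply/ltP; exists t => b; apply/(norm_ltE Hn).
  + move=> B [x Bx Ax]; apply: contrapT => nomin.
    (* Without a least element, every member of [B] in [A] has another one against which I wins.
       Linking these winning strategies by [actI_chain] gives plays [z i], none of them at most
       [z i.+1]. *)
    have next (y : {y : N | B y /\ A y}) :
        {z : {y : N | B y /\ A y} * N |
          forall b, ~ le (pr (sval y) (actI z.2 b)) (pr (sval z.1) b)}.
      apply: cid; case: y => y [By Ay] /=.
      have /existsNP[z /not_implyP[Bz nle]] : ~ forall z, B z -> le' y z.
        by move=> mz; apply: nomin; exists y.
      have Az : A z by apply: contrapT => nAz; apply/nle/out.
      by have /not_leP[t Ht] := nle; exists (exist _ z (conj Bz Az), t).
    pose u i := iter i (fun y => (sval (next y)).1) (exist _ x (conj Bx Ax)).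
    have [a aE] := actI_chain (fun i => (sval (next (u i))).2).
    pose z i := pr (sval (u i)) (a i).
    have [|_ [i _ <-]] := norm_min Hn (B := range z).
      exists (z 0); first by exists 0.
      by have [_ /AP] := svalP (u 0); apply.
    move=> /(_ (z i.+1) (ex_intro2 _ _ i.+1 I erefl)).
    by rewrite /z aE; apply: (svalP (next (u i))).
- apply: Pi1_all_Sigma1; apply: Sigma1_ex.
  apply: (Sigma1_comp (f := fun q : N * N * N * N =>
    (pr q.1.1.1 (actI q.1.2 q.2), pr q.1.1.2 q.2)) _ sle).
  by solve_cont; apply: continuous_actI; solve_cont.
- apply: Pi1_all_Sigma1; apply: Sigma1_ex.
  apply: (Sigma1_comp (f := fun q : N * N * N * N =>
    (pr q.1.1.1 (actII q.1.2 q.2), pr q.1.1.2 q.2)) _ slt).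
  by solve_cont; apply: continuous_actII; solve_cont.
Qed.

Lemma prewellordered_odd n : PD -> prewellordered (Pi1 n.*2.+1).
Proof.
move=> pd; elim: n => [|n IH].
  exact: prewellordered_Pi1 pd prewellordered_open.
by rewrite doubleS; apply: prewellordered_Pi1 => //; exact: prewellordered_Sigma1.
Qed.

(** * The complete equivalence relation *)

Section NormFacts.
Variables (T : Type) (W : set T) (le lt : T -> T -> Prop).
Hypothesis Hn : is_norm W le lt.

Lemma norm_refl x : W x -> le x x.
Proof. by move=> Wx; case: (norm_total Hn Wx Wx). Qed.

Lemma norm_lt_out x y : W x -> ~ W y -> lt x y.
Proof. by move=> Wx nWy; apply/(norm_ltE Hn); split=> // /(norm_dom Hn). Qed.

Lemma norm_lt_nge x y : lt x y -> ~ le y x.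
Proof. by case/(norm_ltE Hn). Qed.

Lemma norm_nlt_ge x y : W x -> ~ lt x y -> le y x.
Proof.
by move=> Wx nlt; apply: contrapT => nle; apply/nlt/(norm_ltE Hn).
Qed.

Lemma norm_ltW x y : lt x y -> le x y.
Proof.
move=> /(norm_ltE Hn)[Wx nle]; have [Wy|nWy] := pselect (W y).
  by case: (norm_total Hn Wx Wy).
exact: (norm_out Hn).
Qed.

End NormFacts.

(* The demands on stage [k+1] of [(y,z)]: it lies above stage [k], above the
   symmetry and transitivity consequences of the pairs whose stage [0] is at
   most stage [k] of [(y,z)], and above stage [j+1] of every pair whose stage
   [j], [j < k], is at most stage [k] of [(y,z)]. Here "at most" is written as
   the failure of the reverse strict inequality, so that every occurrence of
   [lt] is positive; asking this for [j = k] would be circular. *)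
Definition bounds_demands (T Y : Type) (lt : T -> T -> Prop)
    (V : nat -> Y -> Y -> T) (k : nat) (y z : Y) : Prop :=
  lt (V k y z) (V k.+1 y z) /\
  (forall j y' z', k <= j \/
     (lt (V k y z) (V j y' z') \/ lt (V j.+1 y' z') (V k.+1 y z))) /\
  (forall y' z' w, lt (V k y z) (V 0 y' z') \/
     (lt (V k y z) (V 0 z' w) \/ lt (V 0 y' w) (V k.+1 y z))) /\
  (forall y' z', lt (V k y z) (V 0 y' z') \/ lt (V 0 z' y') (V k.+1 y z)).

Section Stages.
Variables (T Y : Type) (W : set T) (le lt : T -> T -> Prop).
Hypothesis Hn : is_norm W le lt.
Variable V : nat -> Y -> Y -> T.
Hypothesis VS : forall k y z, W (V k.+1 y z) <-> bounds_demands lt V k y z.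

Let F y z := forall k, W (V k y z).

(** Stage [m] of the smaller pair stays below stage [(n + m).+1] of the larger; starting from [n.+1]
    secures [m < (n + m).+1], as the second demand requires. *)
Lemma all_stages_below n y z y' z' :
  F y z -> le (V 0 y' z') (V n.+1 y z) -> F y' z'.
Proof.
move=> Fyz l0 m; suff : le (V m y' z') (V (n + m).+1 y z) by apply: (norm_dom Hn).
elim: m => [|m IH]; first by rewrite addn0.
have [_ [/(_ m y' z') + _]] := (VS (n + m).+1 y z).1 (Fyz _).
rewrite leqNgt ltnS leq_addl /= => -[//|[/(norm_lt_nge Hn)//|]].
by rewrite addnS => /(norm_ltW Hn).
Qed.

Lemma all_stages_sym y z : F y z -> F z y.
Proof.
move=> Fyz; have [_ [_ [_ /(_ y z)]]] := (VS 0 y z).1 (Fyz 1).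
case=> [/(norm_lt_nge Hn)[]|]; first exact: norm_refl Hn _ (Fyz 0).
by move=> /(norm_ltW Hn); apply: all_stages_below.
Qed.

(** The pair with the larger stage 0 supplies the transitivity demand. *)
Lemma all_stages_trans y z w : F y z -> F z w -> F y w.
Proof.
move=> Fyz Fzw.
have refl := norm_refl Hn.
case: (norm_total Hn (Fyz 0) (Fzw 0)) => l.
  have [_ [_ [/(_ y z w) + _]]] := (VS 0 z w).1 (Fzw 1).
  case=> [/(norm_lt_nge Hn)//|[/(norm_lt_nge Hn)[]|]]; first exact: refl.
  by move=> /(norm_ltW Hn); apply: all_stages_below.
have [_ [_ [/(_ y z w) + _]]] := (VS 0 y z).1 (Fyz 1).
case=> [/(norm_lt_nge Hn)[]|[/(norm_lt_nge Hn)//|]]; first exact: refl.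
by move=> /(norm_ltW Hn); apply: all_stages_below.
Qed.

Lemma stage0 k y z : W (V k y z) -> W (V 0 y z).
Proof.
elim: k => // k IH /VS[l _]; apply: IH.
by case/(norm_ltE Hn): l.
Qed.

(** If stage [k.+1] were outside [W], every member of [W] would lie strictly below it, so its
    demands would hold and put it into [W]. *)
Lemma all_stages_of_stage0 :
  (forall y z, W (V 0 y z) -> W (V 0 z y)) ->
  (forall y z w, W (V 0 y z) -> W (V 0 z w) -> W (V 0 y w)) ->
  forall y z, W (V 0 y z) -> F y z.
Proof.
move=> sym trans y z Wyz k; move: k y z Wyz.
elim/ltn_ind => -[//|k] IH y z Wyz; apply: contrapT => nW; apply: (nW).
have Wk := IH k (ltnSn k) y z Wyz.
have below j y' z' : ~ lt (V k y z) (V j y' z') -> W (V 0 y' z').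
  by move=> /(norm_nlt_ge Hn Wk)/(norm_dom Hn)/stage0.
have above t : W t -> lt t (V k.+1 y z).
  by move=> Wt; exact: norm_lt_out Hn _ _ Wt nW.
apply/VS; split; [|split; [|split]].
- exact: above.
- move=> j y' z'; have [|jk] := leqP k j; first by left.
  right; have [|/below Wj] := pselect (lt (V k y z) (V j y' z')); first by left.
  by right; apply/above/IH.
- move=> y' z' w.
  have [|/below W1] := pselect (lt (V k y z) (V 0 y' z')); first by left.
  right; have [|/below W2] := pselect (lt (V k y z) (V 0 z' w)); first by left.
  by right; apply/above/(trans _ z').
- move=> y' z'.
  have [|/below W1] := pselect (lt (V k y z) (V 0 y' z')); first by left.
  by right; apply/above/sym.
Qed.

End Stages.

(* A pair [(b, a)] is an index of the section at [a] of the set coded by [b]. *)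
Definition universal_Pi1 (m : nat) (c : N) : Prop :=
  ~ univ m (ev (ev c)) (pr (od (ev c)) (od c)).

Lemma Pi1_univ m (X : topologicalType) (f g : X -> N) :
  continuous f -> continuous g -> Pi1 m (fun x => ~ univ m (f x) (g x)).
Proof.
move=> cf cg; apply: Pi1_not.
apply: (Sigma1_comp (f := fun x => (f x, g x)) _ (Sigma1_univ m)).
by solve_cont.
Qed.

Lemma Pi1_universal_Pi1 m : Pi1 m (universal_Pi1 m).
Proof. by apply: Pi1_univ; solve_cont. Qed.

(* Kleene's recursion theorem: [e] is an index of [A e]. *)
Lemma Pi1_recursion m (A : N -> N -> Prop) :
  Pi1 m (fun q : N * N => A q.1 q.2) ->
  exists e, forall d, universal_Pi1 m (pr e d) <-> A e d.
Proof.
move=> pA.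
(* Diagonalisation: [q] pairs a code with an argument, and the code is doubled to form an index. The
   section at [b'] of the Pi set coded by [b'] is then [A (pr b' b')]. *)
have [b Ab] : exists b : nat -> bool, forall q,
    ~ A (pr (ev q) (ev q)) (od q) <-> univ m (fun i => b i) q.
  apply: univ_complete.
  apply: (Pi1_comp (f := fun q : N => (pr (ev q) (ev q), od q)) _ pA).
  by solve_cont.
pose b' : N := fun i => b i.
exists (pr b' b') => d; rewrite /universal_Pi1 !ev_pr !od_pr -(Ab (pr b' d)).
by rewrite ev_pr od_pr; split=> [/contrapT|Ad]//; apply.
Qed.

(** The number [k] is stored as a constant sequence, to be read back by [num]; [e] is the index to
    which the coded tuple is passed. *)
Definition stage (e x : N) (k : nat) (y z : N) : N :=
  pr e (pr (fun=> k) (pr x (pr y z))).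

Definition num (a : N) : nat := a 0.

Lemma lc_num (X : topologicalType) (f : X -> N) :
  continuous f -> locally_constant (fun x => num (f x)).
Proof. by move=> cf; apply: lc_coord => //; exact: lc_cst. Qed.

Lemma continuous_stage (X : topologicalType) (e x y z : X -> N) (k : X -> nat) :
  continuous e -> continuous x -> locally_constant k -> continuous y ->
  continuous z -> continuous (fun q => stage (e q) (x q) (k q) (y q) (z q)).
Proof.
move=> ce cx lk cy cz; rewrite /stage; solve_cont.
exact: continuous_ptws.
Qed.

Lemma Pi1_all_nat n (X : topologicalType) (P : X -> nat -> Prop) :
  Pi1 n (fun q : X * N => P q.1 (num q.2)) -> Pi1 n (fun x => forall k, P x k).
Proof.
move=> pP; apply: (Pi1_iff _ (Pi1_all (P := fun x y => P x (num y)) pP)) => x.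
by split=> [H k|//]; exact: (H (fun=> k)).
Qed.

Ltac solve_lc := repeat first
  [ assumption | exact: lc_cst | apply: lc_num; solve_cont
  | apply: (lc_app succn) | apply: (lc_app predn) ].

Ltac solve_stage :=
  apply: continuous_stage; solve_cont; solve_lc.

Lemma Pi1_bounds_demands m (lt : N -> N -> Prop) :
  Pi1 m (fun q : N * N => lt q.1 q.2) ->
  Pi1 m (fun q : N * N * N * N * N => bounds_demands lt
    (stage q.1.1.1.1 q.1.1.1.2) (num q.2) q.1.1.2 q.1.2).
Proof.
move=> plt.
have atom (Z : topologicalType) (f g : Z -> N) : continuous f -> continuous g ->
    Pi1 m (fun q => lt (f q) (g q)).
  move=> cf cg; apply: (Pi1_comp (f := fun q => (f q, g q)) _ plt).
  by solve_cont.
rewrite /bounds_demands; apply: Pi1_and; [|apply: Pi1_and; [|apply: Pi1_and]].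
- by apply: atom; solve_stage.
- apply: Pi1_all_nat; do 2!apply: Pi1_all; apply: Pi1_or.
    by apply: Pi1_lc; apply: (lc_app2 leq
      (f := fun q : N * N * N * N * N * N * N * N => num q.1.1.1.2)
      (g := fun q => num q.1.1.2)); solve_lc.
  by apply: Pi1_or; apply: atom; solve_stage.
- by do 3!apply: Pi1_all; do 2?apply: Pi1_or; apply: atom; solve_stage.
- by do 2!apply: Pi1_all; apply: Pi1_or; apply: atom; solve_stage.
Qed.

(** The demands on stage [k.+1] mention that stage itself, so plain recursion on [k] is circular;
    [Pi1_recursion] supplies a self-referring index. *)
Lemma stages_exist m (lt : N -> N -> Prop) :
  Pi1 m (fun q : N * N => lt q.1 q.2) ->
  exists e, forall x,
    (forall y z, universal_Pi1 m (stage e x 0 y z) <-> ~ univ m x (pr y z)) /\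
    (forall k y z, universal_Pi1 m (stage e x k.+1 y z) <->
       bounds_demands lt (stage e x) k y z).
Proof.
move=> plt.
pose A (e d : N) := (num (ev d) == 0 /\ ~ univ m (ev (od d)) (od (od d))) \/
  (num (ev d) != 0 /\ bounds_demands lt (stage e (ev (od d))) (num (ev d)).-1
     (ev (od (od d))) (od (od (od d)))).
have [|e eA] := @Pi1_recursion m A.
  have lc0 : locally_constant (fun q : N * N => num (ev q.2)) by solve_lc.
  apply: Pi1_or; apply: Pi1_and.
  - by apply: Pi1_lc; apply: (lc_app (fun i : nat => i == 0) lc0).
  - by apply: Pi1_univ; solve_cont.
  - by apply: Pi1_lc; apply: (lc_app (fun i : nat => i != 0) lc0).
  apply: (Pi1_comp (f := fun q : N * N => (q.1, ev (od q.2), ev (od (od q.2)),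
    od (od (od q.2)), ((fun=> (num (ev q.2)).-1) : N))) _ (Pi1_bounds_demands plt)).
  by solve_cont; apply: continuous_ptws => i; apply: (lc_app predn lc0).
have stageP x k y z : universal_Pi1 m (stage e x k y z) <->
    (k == 0 /\ ~ univ m x (pr y z)) \/
    (k != 0 /\ bounds_demands lt (stage e x) k.-1 y z).
  by rewrite {1}/stage eA /A !(ev_pr, od_pr).
exists e => x; split=> [y z|k y z]; rewrite stageP.
  by split=> [[[]|[]]//|]; left.
by split=> [[[]|[]]//|]; right.
Qed.

(** * Coding in Cantor space and the reduction *)

Definition even_bits (u : cantor_space) : N := fun i => u i.*2.
Definition odd_bits (u : cantor_space) : N := fun i => u i.*2.+1.

Lemma continuous_bits (j : nat -> nat) :
  continuous ((fun u i => nat_of_bool (u (j i))) : cantor_space -> N).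
Proof.
apply: continuous_ptws => i.
apply: (lc_app nat_of_bool (f := fun u : cantor_space => u (j i))).
exact: (@ptws_lc cantor_space bool (fun u => u) (@continuous_idf _) (j i)).
Qed.

Lemma continuous_borel (X Y : ptopologicalType) (f : X -> Y) :
  continuous f -> borel_fun f.
Proof.
move=> cf.
apply: (@measurability _ _ (g_sigma_algebraType (@open X))
  (g_sigma_algebraType (@open Y)) setT f (@open Y)) => //.
move=> _ [B oB <-]; rewrite setTI; apply: sub_sigma_algebra.
by move/continuousP: cf; apply.
Qed.

Lemma Pi1_eq m (X : topologicalType) (f g : X -> N) :
  continuous f -> continuous g -> Pi1 m.+1 (fun x => f x = g x).
Proof.
move=> cf cg; apply: (Pi1_iff (A := fun x => forall k, f x k == g x k)).
  by move=> x; split=> [e|-> //]; apply/funext => k; apply/eqP.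
apply: Pi1_all_nat; apply: Pi1_lc.
have lc (h : X -> N) :
    continuous h -> locally_constant (fun q : X * N => h q.1 (num q.2)).
  move=> ch; apply: (lc_coord (f := fun q : X * N => h q.1)
    (n := fun q => num q.2)); last by apply: lc_num; solve_cont.
  by apply: (continuous_compf ch); solve_cont.
by apply: (lc_app2 (fun i j : nat => i == j) (lc f cf) (lc g cg)).
Qed.

Definition interleave (a : nat -> bool) (y : cantor_space) : cantor_space :=
  fun i => if odd i then y i./2 else a i./2.

Lemma even_bits_interleave a y : even_bits (interleave a y) = fun i => a i.
Proof.
by apply/funext => i; rewrite /even_bits /interleave odd_double doubleK.
Qed.

Lemma odd_bits_interleave a y : odd_bits (interleave a y) = fun i => y i.
Proof.
apply/funext => i.
by rewrite /odd_bits /interleave /= odd_double /= uphalf_double.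
Qed.

Lemma continuous_interleave a : continuous (interleave a).
Proof.
apply: (@continuous_ptws _ bool) => i; rewrite /interleave.
case: (odd i); last exact: lc_cst.
exact: (@ptws_lc cantor_space bool (fun u => u) (@continuous_idf _) i./2).
Qed.

(** A retraction of Baire space onto the 0-1 sequences, used to pull an equivalence relation back to
    Baire space. *)
Definition to_bits (x : N) : cantor_space := fun i => x i != 0.

Lemma continuous_to_bits : continuous to_bits.
Proof.
apply: (@continuous_ptws _ bool) => i; rewrite /to_bits.
apply: (lc_app (fun k : nat => k != 0) (f := fun x : N => x i)).
exact: (@ptws_lc N nat (fun u => u) (@continuous_idf _) i).
Qed.

Lemma to_bitsK (y : cantor_space) : to_bits (fun i => y i) = y.
Proof. by apply/funext => i; rewrite /to_bits; case: (y i). Qed.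

Theorem mainTheorem6 :
  PD ->
  forall n : nat,
    exists2 F : cantor_space -> cantor_space -> Prop,
      Pi1_equivalence (2 * n + 1) F &
      forall E : cantor_space -> cantor_space -> Prop,
        Pi1_equivalence (2 * n + 1) E -> borel_reducible E F.
Proof.
move=> pd n; rewrite addn1 mul2n; set m := n.*2.+1.
have [le [lt [Hn _ plt]]] := @prewellordered_odd n pd _ (Pi1_universal_Pi1 m).
have [e /all_and2[V0 VS]] := stages_exist plt.
(* The even bits hold the parameter, the odd bits the point. Distinct parameters are never related,
   and the diagonal makes every section reflexive. *)
pose F u v := even_bits u = even_bits v /\
  (odd_bits u = odd_bits v \/
    forall k, universal_Pi1 m (stage e (even_bits u) k (odd_bits u) (odd_bits v))).
exists F.
  split.
    split=> [u|u v [euv Fuv]|u v w [euv Fuv] [evw Fvw]].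
    - by split=> //; left.
    - split=> //; rewrite -euv; case: Fuv => [->|Fuv]; [by left | right].
      exact: (all_stages_sym Hn (VS _)).
    - split; first by rewrite euv.
      case: Fuv => [->|Fuv]; first by rewrite euv.
      case: Fvw => [<-|Fvw]; first by right.
      by right; apply: (all_stages_trans Hn (VS _) Fuv); rewrite euv.
  have c0 := @continuous_bits double.
  have c1 := @continuous_bits (fun i => i.*2.+1).
  have cont (f : cantor_space -> N) : continuous f ->
      continuous (fun p : cantor_space * cantor_space => f p.1) /\
      continuous (fun p : cantor_space * cantor_space => f p.2).
    by move=> cf; split; apply: (continuous_compf cf); solve_cont.
  have [c01 c02] := cont _ c0; have [c11 c12] := cont _ c1.
  apply: Pi1_and; first exact: Pi1_eq.
  apply: Pi1_or; first exact: Pi1_eq.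
  apply: Pi1_all_nat.
  have lift (f : cantor_space * cantor_space -> N) : continuous f ->
      continuous (fun q : cantor_space * cantor_space * N => f q.1).
    by move=> cf; apply: (continuous_compf cf); solve_cont.
  apply: Pi1_comp (Pi1_universal_Pi1 m).
  apply: continuous_stage; last 2 first.
  - exact: (lift _ c11).
  - exact: (lift _ c12).
  - exact: continuous_cstf.
  - exact: (lift _ c01).
  - by apply: lc_num; solve_cont.
move=> E [eqE pE].
(* [a] codes the complement of [E] pulled back along [to_bits], so stage 0 at parameter [a]
   expresses [E] itself. *)
have [a Ea] : exists a : nat -> bool, forall q,
    ~ E (to_bits (ev q)) (to_bits (od q)) <-> univ m (fun i => a i) q.
  apply: univ_complete.
  apply: (Pi1_comp (f := fun q : N => (to_bits (ev q), to_bits (od q))) _ pE).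
  by apply: continuous_pair; apply: (continuous_compf continuous_to_bits);
    solve_cont.
pose a' : N := fun i => a i.
have E0 y z : universal_Pi1 m (stage e a' 0 y z) <-> E (to_bits y) (to_bits z).
  by rewrite V0 -(Ea (pr y z)) ev_pr od_pr; split=> [/contrapT|Eyz]//; apply.
exists (interleave a); first exact: continuous_borel (@continuous_interleave a).
move=> y z; rewrite /F !even_bits_interleave !odd_bits_interleave.
split=> [Eyz|[_ [eyz|/(_ 0)/E0]]].
- split=> //; right; apply: (all_stages_of_stage0 Hn (VS a')).
  + by move=> u v /E0 Euv; apply/E0; symmetry.
  + by move=> u v w /E0 Euv /E0 Evw; apply/E0; transitivity (to_bits v).
  + by apply/E0; rewrite !to_bitsK.
- by rewrite -(to_bitsK y) eyz to_bitsK; reflexivity.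
- by rewrite !to_bitsK.
Qed.
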